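(* Let $\Omega=\{\omega_1,\omega_2\}$, $S=\{s_1,s_2\}$, let $\sigma\in\Sigma^1$, let $\rho$ be an experiment and let $\tau\in(0,1)$, so that $(\sigma,\rho,\tau,p)_{p\in(0,1)}$ is a family of agents with common $\sigma,\rho,\tau$, and suppose there is no backfire at $\sigma$. The family of agents: (1) exhibits $\omega_{1}$-biased updating if and only if $$\sigma(s_{1}\mid\omega_{1})\geq\rho(s_{1}\mid\omega_{1})\quad\text{and}\quad\sigma(s_{1}\mid\omega_{2})\geq\rho(s_{1}\mid\omega_{2}),$$ where at least one of the two inequalities is strict; (2) exhibits confirmatory updating if and only if $$\sigma(s_{1}\mid\omega_{1})>\rho(s_{1}\mid\omega_{1})\quad\text{and}\quad\sigma(s_{2}\mid\omega_{2})>\rho(s_{2}\mid\omega_{2});$$ (3) exhibits average base-rate neglect if and only if $$\sigma(s_{1}\mid\omega_{1})<\rho(s_{1}\mid\omega_{1})\quad\text{and}\quad\sigma(s_{2}\mid\omega_{2})<\rho(s_{2}\mid\omega_{2}).$$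
   Context: An experiment is a map $e:\Omega\to\Delta(S)$, written $e(s\mid\omega)$. $\Sigma^1$ is the set of experiments $\sigma$ with $0<\sigma(s_1\mid\omega_2)<\sigma(s_1\mid\omega_1)<1$. A prior is indexed by $p\in(0,1)$, with $p(\omega_1)=p$ and $p(\omega_2)=1-p$. For an experiment $e$, $e_p(s)=\sum_{\omega\in\Omega}e(s\mid\omega)p(\omega)$ and $p^*_e(\omega\mid s)=e(s\mid\omega)p(\omega)/e_p(s)$. The agent with prior $p$ has posterior $p_\sigma(\omega\mid s)=p^*_{\tau\sigma+(1-\tau)\rho}(\omega\mid s)$, while signals are generated by $\sigma$; her average posterior on $\omega$ is $$\bar q_p(\omega)=\sum_{s\in S}p^*_{\tau\sigma+(1-\tau)\rho}(\omega\mid s)\,\sigma_p(s).$$ No backfire at $\sigma$: for all $s\in S$, $\omega\in\Omega$ (and for the agents' priors $p\in(0,1)$), $p^*_\sigma(\omega\mid s)\le p(\omega)\iff p_\sigma(\omega\mid s)\le p(\omega)$. The family $(\sigma,\rho,\tau,p)_{p\in(0,1)}$ exhibits: - $\omega$-biased updating if $\bar q_p(\omega)>p(\omega)$ for all $p\in(0,1)$; - confirmatory updating if there exists $\theta\in(0,1)$ such that, for any $\omega\in\Omega$, $\bar q_p(\omega)>p(\omega)$ whenever $p(\omega)>\theta$; - average base-rate neglect if there exists $\theta\in(0,1)$ such that, for any $\omega\in\Omega$, $\bar q_p(\omega)>p(\omega)$ whenever $p(\omega)<\theta$. *)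

(* Defs.v *)
From mathcomp Require Import all_boot all_order all_algebra.
From mathcomp Require Import reals.

Set Implicit Arguments.
Unset Strict Implicit.
Unset Printing Implicit Defensive.

Import Order.TTheory GRing.Theory Num.Theory.
Local Open Scope ring_scope.

Section Experiments.
Context {R : realType} {Omega S : finType}.

Definition is_dist (mu : S -> R) : Prop :=
  (forall s, 0 <= mu s) /\ \sum_s mu s = 1.

(* [e w s] stands for e(s | w). *)
Definition is_experiment (e : Omega -> S -> R) : Prop :=
  forall w, is_dist (e w).

Definition signal_prob (e : Omega -> S -> R) (pi : Omega -> R) (s : S) : R :=
  \sum_w e w s * pi w.

(* The quotient is 0 on signals of probability 0; this case does not occur for
   full-support experiments and priors. *)
Definition bayes (e : Omega -> S -> R) (pi : Omega -> R) (w : Omega) (s : S)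
    : R :=
  e w s * pi w / signal_prob e pi s.

Definition mixture (tau : R) (sigma rho : Omega -> S -> R) : Omega -> S -> R :=
  fun w s => tau * sigma w s + (1 - tau) * rho w s.

Definition agent_posterior (sigma rho : Omega -> S -> R) (tau : R)
    (pi : Omega -> R) (w : Omega) (s : S) : R :=
  bayes (mixture tau sigma rho) pi w s.

(* The agent updates with the mixture, but signals are drawn from [sigma]. *)
Definition avg_posterior (sigma rho : Omega -> S -> R) (tau : R)
    (pi : Omega -> R) (w : Omega) : R :=
  \sum_s agent_posterior sigma rho tau pi w s * signal_prob sigma pi s.

End Experiments.

Definition state : finType := 'I_2.
Definition signal : finType := 'I_2.
Definition omega1 : state := ord0.
Definition omega2 : state := ord_max.
Definition s1 : signal := ord0.
Definition s2 : signal := ord_max.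

Section BinaryFamily.
Context {R : realType}.
Implicit Types (sigma rho : state -> signal -> R) (tau p theta : R).

Definition Sigma1 sigma : Prop :=
  [/\ is_experiment sigma,
      0 < sigma omega2 s1,
      sigma omega2 s1 < sigma omega1 s1
    & sigma omega1 s1 < 1].

Definition prior p (w : state) : R := if w == omega1 then p else 1 - p.

Definition no_backfire sigma rho tau : Prop :=
  forall p, 0 < p < 1 -> forall (s : signal) (w : state),
    bayes sigma (prior p) w s <= prior p w <->
    agent_posterior sigma rho tau (prior p) w s <= prior p w.

Definition biased_updating (w : state) sigma rho tau : Prop :=
  forall p, 0 < p < 1 -> avg_posterior sigma rho tau (prior p) w > prior p w.

Definition confirmatory_updating sigma rho tau : Prop :=
  exists theta, 0 < theta < 1 /\
    forall (w : state) p, 0 < p < 1 -> prior p w > theta ->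
      avg_posterior sigma rho tau (prior p) w > prior p w.

Definition average_base_rate_neglect sigma rho tau : Prop :=
  exists theta, 0 < theta < 1 /\
    forall (w : state) p, 0 < p < 1 -> prior p w < theta ->
      avg_posterior sigma rho tau (prior p) w > prior p w.

End BinaryFamily.

(* Main.v *)
(** Put x = σ(s1|ω1) - ρ(s1|ω1) and y = σ(s1|ω2) - ρ(s1|ω2).  No backfire
    makes s1 favour ω1 under the mixture as well as under σ, and then
    [avg_posterior] - [prior] at ω1 has the sign of p x + (1 - p) y, while the
    excess at ω2 is its opposite.  The three properties thus reduce to the sign
    of an affine function of p near the endpoints of (0, 1), where its values
    tend to y and x. *)
Require Import Defs.
From mathcomp Require Import all_boot all_order all_algebra.
From mathcomp Require Import reals.
From mathcomp Require Import ring lra.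
Import Order.TTheory GRing.Theory Num.Theory.
Local Open Scope ring_scope.

Set Implicit Arguments.
Unset Strict Implicit.

Lemma sum_ord2 (V : nmodType) (f : 'I_2 -> V) :
  \sum_i f i = f ord0 + f ord_max.
Proof.
rewrite !big_ord_recl big_ord0 addr0; congr (_ + f _).
exact: val_inj.
Qed.

Lemma ord2_cases (P : 'I_2 -> Prop) : P ord0 -> P ord_max -> forall i, P i.
Proof.
move=> P0 P1 [[|[|//]] i_lt2].
- by rewrite (_ : Ordinal i_lt2 = ord0) //; apply: val_inj.
- by rewrite (_ : Ordinal i_lt2 = ord_max) //; apply: val_inj.
Qed.

(** The affine function equals [x] at [t = 0] and [y] at [t = 1]. Positivity just to the right of 0
    forces [x >= 0], and when [x = 0] the sign is that of [y]. *)
Lemma affine_pos_near0 (F : realFieldType) (e x y : F) :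
  0 < e -> (forall t, 0 < t < e -> 0 < (1 - t) * x + t * y) ->
  0 <= x /\ (0 < x \/ 0 < y).
Proof.
move=> e_gt0 pos.
have half_in : 0 < e / 2 < e by apply/andP; split; lra.
have pos_half := pos _ half_in.
have x_ge0 : 0 <= x.
  case: (lerP 0 x) => // x_lt0.
  have yx_gt0 : 0 < y - x by nra.
  (* Otherwise there is a root at t = - x / (y - x), below e / 2. *)
  have root_in : 0 < - x / (y - x) < e.
    rewrite divr_gt0 //=; last by lra.
    by rewrite ltr_pdivrMr //; nra.
  have := pos _ root_in.
  rewrite (_ : _ + _ = 0) ?ltxx //; field; lra.
split=> //; case: (lerP x 0) => [x_le0|]; last by left.
by right; have x0 : x = 0 by [lra]; move: pos_half; rewrite x0; nra.
Qed.

(** * Binary experiments, Bayes' rule and the mixture *)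

Section Binary.
Variable R : realType.
Implicit Types (e sigma rho : state -> signal -> R) (tau p : R).

Lemma experiment_s2 e w : is_experiment e -> e w s2 = 1 - e w s1.
Proof. by case/(_ w) => _; rewrite sum_ord2 => <-; rewrite addrAC subrr add0r. Qed.

Lemma experiment_bounds e w : is_experiment e -> 0 <= e w s1 <= 1.
Proof.
move=> he; have [ge0 _] := he w; rewrite ge0 /=.
by have := ge0 s2; rewrite experiment_s2 // subr_ge0.
Qed.

Lemma mixture_experiment sigma rho tau :
  is_experiment sigma -> is_experiment rho -> 0 < tau < 1 ->
  is_experiment (mixture tau sigma rho).
Proof.
move=> hs hr /andP[tau_gt0 tau_lt1] w.
have [s_ge0 s_sum] := hs w; have [r_ge0 r_sum] := hr w.
split=> [s|]; first by rewrite addr_ge0 // mulr_ge0 // ?s_ge0 ?r_ge0; lra.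
by rewrite big_split /= -!mulr_sumr s_sum r_sum; ring.
Qed.

Lemma signal_prob_prior e p s :
  signal_prob e (prior p) s = e omega1 s * p + e omega2 s * (1 - p).
Proof. by rewrite /signal_prob sum_ord2. Qed.

(** Once the denominator is cleared, both sides differ by [p * (1 - p)] times the difference of the
    likelihoods of [s1], so the prior drops out of the comparison. *)
Lemma bayes_omega1_s1_le_prior e p :
  0 < p < 1 -> 0 < e omega1 s1 -> 0 < e omega2 s1 ->
  (bayes e (prior p) omega1 s1 <= p) = (e omega1 s1 <= e omega2 s1).
Proof.
move=> /andP[p_gt0 p_lt1] e1_gt0 e2_gt0.
rewrite /bayes signal_prob_prior [prior p omega1]/prior eqxx.
rewrite ler_pdivrMr ?addr_gt0 ?mulr_gt0 ?subr_gt0 // -subr_ge0.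
rewrite (_ : _ - _ = p * (1 - p) * (e omega2 s1 - e omega1 s1)); last by ring.
by rewrite pmulr_rge0 ?subr_ge0 // mulr_gt0 ?subr_gt0.
Qed.


(** The positive weight on [sigma] keeps the mixture interior even where [rho] is degenerate, so the
    denominators in Bayes' rule do not vanish. *)
Lemma mixture_s1_in01 sigma rho tau w :
  is_experiment rho -> 0 < tau < 1 -> 0 < sigma w s1 < 1 ->
  0 < mixture tau sigma rho w s1 < 1.
Proof.
move=> hr /andP[t_gt0 t_lt1] /andP[? ?]; rewrite /mixture.
have /andP[? ?] := experiment_bounds w hr.
have t'_ge0 : 0 <= 1 - tau by rewrite subr_ge0 ltW.
apply/andP; split; first by rewrite ltr_wpDr ?mulr_ge0 ?mulr_gt0.
rewrite -subr_gt0.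
rewrite (_ : _ - _ = tau * (1 - sigma w s1) + (1 - tau) * (1 - rho w s1)).
  by rewrite ltr_wpDr ?mulr_ge0 ?mulr_gt0 ?subr_gt0 // subr_ge0.
by ring.
Qed.

Lemma signal_prob_prior_s1_in01 e p :
  0 < p < 1 -> 0 < e omega1 s1 < 1 -> 0 < e omega2 s1 < 1 ->
  0 < signal_prob e (prior p) s1 < 1.
Proof.
move=> /andP[? ?] /andP[? ?] /andP[? ?]; rewrite signal_prob_prior.
rewrite addr_gt0 ?mulr_gt0 ?subr_gt0 //= -subr_gt0.
rewrite (_ : _ - _ = (1 - e omega1 s1) * p + (1 - e omega2 s1) * (1 - p)).
  by rewrite addr_gt0 ?mulr_gt0 ?subr_gt0.
by ring.
Qed.

Lemma signal_prob_prior_s2 e p :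
  is_experiment e ->
  signal_prob e (prior p) s2 = 1 - signal_prob e (prior p) s1.
Proof. by move=> he; rewrite !signal_prob_prior !experiment_s2 //; ring. Qed.

Lemma signal_prob_sub_mixture sigma rho tau p s :
  signal_prob sigma (prior p) s
    - signal_prob (mixture tau sigma rho) (prior p) s =
  (1 - tau) * (p * (sigma omega1 s - rho omega1 s)
               + (1 - p) * (sigma omega2 s - rho omega2 s)).
Proof. by rewrite !signal_prob_prior /mixture; ring. Qed.

(** * Closed form of the average posterior *)

Section Excess.
Variables (sigma rho : state -> signal -> R) (tau p : R).
Hypotheses (hsigma : is_experiment sigma) (hrho : is_experiment rho).
Hypothesis htau : 0 < tau < 1.
Let mu := mixture tau sigma rho.
Let M := signal_prob mu (prior p) s1.
Hypothesis M01 : 0 < M < 1.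

Let hmu : is_experiment mu. Proof. exact: mixture_experiment. Qed.

(** If [s1] had probability [M], the posteriors would average to [p]. Drawing from [sigma] instead
    shifts the average by the change in the probability of [s1] times the gap between the posteriors
    after [s1] and [s2], which is [p * (1 - p) * (mu omega1 s1 - mu omega2 s1) / (M * (1 - M))]. *)
Lemma avg_posterior_omega1 :
  avg_posterior sigma rho tau (prior p) omega1 =
  p + p * (1 - p) * (mu omega1 s1 - mu omega2 s1)
      * (signal_prob sigma (prior p) s1 - M) / (M * (1 - M)).
Proof.
case/andP: M01; rewrite /avg_posterior sum_ord2 /agent_posterior /bayes.
rewrite -/mu -/s1 -/s2 !signal_prob_prior_s2 // -/M.
rewrite [prior p omega1]/prior eqxx experiment_s2 //.
(* The identity holds for every value of [A]; only [M] has to be expanded in terms of [mu]. *)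
move: (signal_prob sigma _ _) => A.
rewrite /M signal_prob_prior => M_gt0 M_lt1; field.
by apply/andP; split; lra.
Qed.

(** After each signal the posteriors of the two states sum to 1, and so do the signal
    probabilities. *)
Lemma avg_posterior_omega2 :
  avg_posterior sigma rho tau (prior p) omega2 =
  1 - avg_posterior sigma rho tau (prior p) omega1.
Proof.
case/andP: M01; rewrite /avg_posterior !sum_ord2 /agent_posterior /bayes.
rewrite -/mu -/s1 -/s2 !signal_prob_prior_s2 // -/M.
rewrite /prior /= !(experiment_s2 _ hmu).
move: (signal_prob sigma _ _) => A.
rewrite /M signal_prob_prior => M_gt0 M_lt1; field.
by apply/andP; split; lra.
Qed.

End Excess.

(** One instance suffices: [s1], [omega1] and the prior 1/2. Under [sigma] the posterior exceeds the
    prior there, so it must do so under the mixture, which orders the likelihoods. *)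
Lemma no_backfire_mixture_lt sigma rho tau :
  Sigma1 sigma -> is_experiment rho -> 0 < tau < 1 ->
  no_backfire sigma rho tau ->
  mixture tau sigma rho omega2 s1 < mixture tau sigma rho omega1 s1.
Proof.
move=> [hs b_gt0 b_lt_a a_lt1] hr ht nb.
have half01 : 0 < (1 / 2 : R) < 1 by apply/andP; split; lra.
have /andP[m_gt0 _] : 0 < mixture tau sigma rho omega1 s1 < 1.
  by apply: mixture_s1_in01 => //; apply/andP; split; lra.
have /andP[n_gt0 _] : 0 < mixture tau sigma rho omega2 s1 < 1.
  by apply: mixture_s1_in01 => //; apply/andP; split; lra.
have [_] := nb _ half01 s1 omega1; rewrite /agent_posterior.
rewrite [prior _ omega1]/prior eqxx !bayes_omega1_s1_le_prior //; last by lra.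
by case: (ltP (mixture tau sigma rho omega2 s1)) => // _ /(_ isT); lra.
Qed.

(** * Sign of the excess over the prior *)

Section Sign.
Variables (sigma rho : state -> signal -> R) (tau p : R).
Hypotheses (hsigma : Sigma1 sigma) (hrho : is_experiment rho).
Hypotheses (htau : 0 < tau < 1) (hnb : no_backfire sigma rho tau).
Hypothesis hp : 0 < p < 1.
Let L := p * (sigma omega1 s1 - rho omega1 s1)
  + (1 - p) * (sigma omega2 s1 - rho omega2 s1).

Let excess : exists2 c : R, 0 < c &
  avg_posterior sigma rho tau (prior p) omega1 = p + c * L /\
  avg_posterior sigma rho tau (prior p) omega2 = 1 - p - c * L.
Proof.
have [hs b_gt0 b_lt_a a_lt1] := hsigma.
have m01 := @mixture_s1_in01 sigma rho tau omega1 hrho htau.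
have n01 := @mixture_s1_in01 sigma rho tau omega2 hrho htau.
have M01 : 0 < signal_prob (mixture tau sigma rho) (prior p) s1 < 1.
  by apply: signal_prob_prior_s1_in01; [|apply: m01|apply: n01];
    rewrite //; apply/andP; split; lra.
have nm := no_backfire_mixture_lt hsigma hrho htau hnb.
rewrite avg_posterior_omega2 // avg_posterior_omega1 //.
rewrite signal_prob_sub_mixture -/L.
move: M01 => /andP[]; move: (signal_prob _ _ _) => M M_gt0 M_lt1.
case/andP: htau => _ tau_lt1; case/andP: hp => p_gt0 p_lt1.
move: nm; move: (mixture _ _ _ omega1 s1) (mixture _ _ _ omega2 s1) => m n nm.
(* The gap between the posteriors times the factor [1 - tau] from [signal_prob_sub_mixture]; it is
   positive because [n < m]. *)
exists (p * (1 - p) * (m - n) * (1 - tau) / (M * (1 - M))).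
  by rewrite divr_gt0 ?mulr_gt0 ?subr_gt0.
by split; field; apply/andP; split; lra.
Qed.

Lemma prior_lt_avg_omega1 :
  prior p omega1 < avg_posterior sigma rho tau (prior p) omega1 <-> 0 < L.
Proof.
have [c c_gt0 [-> _]] := excess.
by rewrite /prior eqxx ltrDl pmulr_rgt0.
Qed.

Lemma prior_lt_avg_omega2 :
  prior p omega2 < avg_posterior sigma rho tau (prior p) omega2 <-> L < 0.
Proof.
have [c c_gt0 [_ ->]] := excess.
by rewrite /prior /= ltrDl oppr_gt0 pmulr_rlt0.
Qed.

End Sign.
End Binary.

(** * The three characterisations *)

Unset Implicit Arguments.

Theorem proposition5 (R : realType) (sigma rho : state -> signal -> R) (tau : R)
    (hsigma : Sigma1 sigma) (hrho : is_experiment rho) (htau : 0 < tau < 1)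
    (hnb : no_backfire sigma rho tau) :
  (biased_updating omega1 sigma rho tau <->
     (sigma omega1 s1 >= rho omega1 s1 /\ sigma omega2 s1 >= rho omega2 s1) /\
     (sigma omega1 s1 > rho omega1 s1 \/ sigma omega2 s1 > rho omega2 s1)) /\
  (confirmatory_updating sigma rho tau <->
     sigma omega1 s1 > rho omega1 s1 /\ sigma omega2 s2 > rho omega2 s2) /\
  (average_base_rate_neglect sigma rho tau <->
     sigma omega1 s1 < rho omega1 s1 /\ sigma omega2 s2 < rho omega2 s2).
Proof.
have [hs _ _ _] := hsigma.
have L1 p hp := @prior_lt_avg_omega1 R sigma rho tau p hsigma hrho htau hnb hp.
have L2 p hp := @prior_lt_avg_omega2 R sigma rho tau p hsigma hrho htau hnb hp.
rewrite !experiment_s2 //.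
have xE : sigma omega1 s1 = rho omega1 s1 + (sigma omega1 s1 - rho omega1 s1).
  by ring.
have yE : sigma omega2 s1 = rho omega2 s1 + (sigma omega2 s1 - rho omega2 s1).
  by ring.
move: L1 L2 xE yE; set x := _ - _; set y := _ - _ => L1 L2 xE yE.
(* A small [t] serves both endpoints: [p = t] approaches 0 and [p = 1 - t] approaches 1. *)
have to01 (t e : R) : 0 < t < e -> e <= 1 -> 0 < t < 1 /\ 0 < 1 - t < 1.
  by move=> /andP[? ?] ?; split; apply/andP; split; lra.
split; [|split]; split.
- move=> bias.
  have [y_ge0 _] : 0 <= y /\ (0 < y \/ 0 < x).
    apply: (@affine_pos_near0 _ 1) => // t ht.
    by rewrite addrC; apply/(L1 t ht); exact: bias.
  have [x_ge0 xy_gt0] : 0 <= x /\ (0 < x \/ 0 < y).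
    apply: (@affine_pos_near0 _ 1) => // t ht.
    have [_ ht'] := to01 _ _ ht (lexx _).
    have /(L1 _ ht') := bias _ ht'.
    lra.
  by split; [split; lra|case: xy_gt0 => ?; [left|right]; lra].
- move=> [[? ?] xy] p hp; apply/(L1 p hp); case/andP: hp => ? ?.
  by case: xy => ?; nra.
- move=> [theta [/andP[? ?] conf]].
  have [x_ge0 xy_gt0] : 0 <= x /\ (0 < x \/ 0 < y).
    apply: (@affine_pos_near0 _ (1 - theta)); first by lra.
    move=> t ht; have [_ ht'] := to01 _ _ ht ltac:(lra).
    have : theta < prior (1 - t) omega1 by rewrite /prior eqxx; lra.
    by move=> /(conf _ _ ht') /(L1 _ ht'); lra.
  have [y_le0 yx_lt0] : 0 <= - y /\ (0 < - y \/ 0 < - x).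
    apply: (@affine_pos_near0 _ (1 - theta)); first by lra.
    move=> t ht; have [ht' _] := to01 _ _ ht ltac:(lra).
    have : theta < prior t omega2 by rewrite /prior /=; lra.
    by move=> /(conf _ _ ht') /(L2 _ ht'); lra.
  (* With [x >= 0] and [y <= 0], only the alternatives [0 < x] and [0 < - y] survive. *)
  by case: xy_gt0; case: yx_lt0; split; lra.
- move=> [x_gt0 y_lt0].
  (* This is the root of [p * x + (1 - p) * y], which is negative below it and positive above it. *)
  have r01 : 0 < - y / (x - y) < 1.
    by rewrite divr_gt0 /= ?ltr_pdivrMr; lra.
  have rE : - y / (x - y) * (x - y) = - y by field; lra.
  move: r01 rE; move: (- y / _) => r /andP[? ?] rE.
  (* State [omega1] needs [p > r]; state [omega2] needs [p < r], that is, a prior [1 - p > 1 - r].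
     The maximum covers both. *)
  exists (Num.max r (1 - r)); split; first by rewrite lt_max gt_max; lra.
  apply: ord2_cases => p hp; rewrite gt_max => /andP[].
  + by rewrite {1 2}/prior eqxx => ? ?; apply/(L1 p hp); nra.
  + by rewrite {1 2}/prior /= => ? ?; apply/(L2 p hp); nra.
- move=> [theta [/andP[? ?] neg]].
  have [y_ge0 yx_gt0] : 0 <= y /\ (0 < y \/ 0 < x).
    apply: (@affine_pos_near0 _ theta) => // t ht.
    have [ht' _] := to01 _ _ ht ltac:(lra).
    have : prior t omega1 < theta by rewrite /prior eqxx; lra.
    by move=> /(neg _ _ ht') /(L1 _ ht'); lra.
  have [x_le0 xy_lt0] : 0 <= - x /\ (0 < - x \/ 0 < - y).
    apply: (@affine_pos_near0 _ theta) => // t ht.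
    have [_ ht'] := to01 _ _ ht ltac:(lra).
    have : prior (1 - t) omega2 < theta by rewrite /prior /=; lra.
    by move=> /(neg _ _ ht') /(L2 _ ht'); lra.
  by case: yx_gt0; case: xy_lt0; split; lra.
- move=> [x_lt0 y_gt0].
  have r01 : 0 < y / (y - x) < 1.
    by rewrite divr_gt0 /= ?ltr_pdivrMr; lra.
  have rE : y / (y - x) * (y - x) = y by field; lra.
  move: r01 rE; move: (y / _) => r /andP[? ?] rE.
  (* The affine function now decreases through its root [r], so [omega1] needs [p < r] and [omega2]
     needs [1 - p < 1 - r]. *)
  exists (Num.min r (1 - r)); split; first by rewrite gt_min lt_min; lra.
  apply: ord2_cases => p hp; rewrite lt_min => /andP[].
  + by rewrite {1 2}/prior eqxx => ? ?; apply/(L1 p hp); nra.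
  + by rewrite {1 2}/prior /= => ? ?; apply/(L2 p hp); nra.
Qed.
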